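(* Let $m \ge 0$, $l = 2m+1$, and let $k$ be an integer with $0 \le k < l$. Then the set of positions $(a,b)$ with $a \le b$ having nim-value $1$ in the game $W_{k,l}$ is \[ \{ (2i,2i+1) : 0 \le i \le m \} \cup \{ (l+1,l+1) \} \cup \{ (A_n+l,\, B_n+l+1) : n = \lfloor j\phi^2 \rfloor \text{ for some integer } j \ge 1 \} \cup \{ (A_n+l+1,\, B_n+l+2) : n = \lfloor j\phi \rfloor \text{ for some integer } j \ge 1 \}. \]
   Context: $\phi = \frac{1+\sqrt5}{2}$, $A_n = \lfloor n\phi \rfloor$ and $B_n = \lfloor n\phi^2 \rfloor$. Positions are pairs $(a,b)$ of nonnegative integers. For integers $0 \le k \le l$, the impartial game $W_{k,l}$ (normal play: last player able to move wins) allows from $(a,b)$: a Nim move to $(a-s,b)$ or $(a,b-s)$ for any integer $s>0$ keeping coordinates nonnegative; and a diagonal move to $(a-s,b-s)$ with $s>0$, allowed only if $\min(a-s,b-s) \ge k$ and $\max(a-s,b-s) \ge l$. The nim-value (Sprague–Grundy value) of a position is the minimum excluded nonnegative integer of the set of nim-values of positions reachable in one move (terminal positions have nim-value $0$). *)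

(* Defs.v *)
From HB Require Import structures.
From mathcomp Require Import all_boot all_order all_algebra.
From mathcomp Require Import zify.
From mathcomp Require Import mathcomp_extra boolp classical_sets reals.

Set Implicit Arguments.
Unset Strict Implicit.
Unset Printing Implicit Defensive.

Import Order.TTheory GRing.Theory Num.Theory.

Definition position : Type := (nat * nat)%type.

Definition options (k l : nat) (p : position) : seq position :=
  let: (a, b) := p in
  [seq (a - s, b) | s <- iota 1 a]
  ++ [seq (a, b - s) | s <- iota 1 b]
  ++ [seq (a - s, b - s) | s <- iota 1 (minn a b)
        & (k <= minn (a - s) (b - s)) && (l <= maxn (a - s) (b - s))].

Definition mex (s : seq nat) : nat :=
  find (fun n => n \notin s) (iota 0 (size s).+1).

(* Every move decreases the sum of the coordinates, so [a + b + 1] units of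
   fuel suffice for the recursion from [(a, b)]; see [nim_valueE]. *)
Fixpoint nim_value_fuel (fuel k l : nat) (p : position) : nat :=
  if fuel is f.+1 then mex [seq nim_value_fuel f k l q | q <- options k l p]
  else 0.

Definition nim_value (k l : nat) (p : position) : nat :=
  nim_value_fuel (p.1 + p.2).+1 k l p.

Definition phi (R : realType) : R := ((1 + Num.sqrt 5) / 2)%R.

(* [Num.truncn] is the floor, with values in [nat], on nonnegative reals. *)
Definition wythA (R : realType) (n : nat) : nat :=
  Num.truncn (n%:R * phi R)%R.

Definition wythB (R : realType) (n : nat) : nat :=
  Num.truncn (n%:R * phi R ^+ 2)%R.

Lemma mem_options (k l a b : nat) (q : position) :
  reflect
    (exists2 s, 0 < s &
       [\/ s <= a /\ q = (a - s, b),
           s <= b /\ q = (a, b - s)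
         | [/\ s <= a, s <= b, q = (a - s, b - s),
               k <= minn (a - s) (b - s) & l <= maxn (a - s) (b - s)]])
    (q \in options k l (a, b)).
Proof.
apply: (iffP idP).
- rewrite /options !mem_cat => /or3P[] /mapP[s].
  + by rewrite mem_iota => sa ->; exists s; [lia | constructor 1; split => //; lia].
  + by rewrite mem_iota => sb ->; exists s; [lia | constructor 2; split => //; lia].
  + rewrite mem_filter mem_iota => /andP[/andP[kP lP] sP] ->.
    by exists s; [lia | constructor 3; split => //; lia].
- case=> s s0 H; rewrite /options !mem_cat; apply/or3P.
  case: H => [[sa ->]|[sb ->]|[sa sb -> kP lP]].
  + by constructor 1; apply/mapP; exists s => //; rewrite mem_iota; lia.
  + by constructor 2; apply/mapP; exists s => //; rewrite mem_iota; lia.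
  + by constructor 3; apply/mapP; exists s => //; rewrite mem_filter kP lP mem_iota; lia.
Qed.

Lemma mexP (s : seq nat) :
  mex s \notin s /\ (forall n, n < mex s -> n \in s).
Proof.
have hs : has (fun n => n \notin s) (iota 0 (size s).+1).
  apply/negPn/negP => /hasPn H.
  have sub : {subset iota 0 (size s).+1 <= s} by move=> n /H; rewrite negbK.
  by have := uniq_leq_size (iota_uniq _ _) sub; rewrite size_iota ltnn.
have lt : mex s < (size s).+1 by move: (hs); rewrite has_find size_iota.
split; first by have := nth_find 0 hs; rewrite -/(mex s) nth_iota.
move=> n nm; have := before_find 0 nm.
by rewrite nth_iota ?(ltn_trans nm) //= => /negbFE.
Qed.

Lemma options_decr (k l : nat) (p q : position) :
  q \in options k l p -> q.1 + q.2 < p.1 + p.2.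
Proof.
by case: p => a b /mem_options[s s0 [[? ->]|[? ->]|[? ? -> _ _]]] /=; lia.
Qed.

Lemma nim_value_fuelE (f k l : nat) (p : position) :
  p.1 + p.2 < f -> nim_value_fuel f k l p = nim_value k l p.
Proof.
suff H g h : p.1 + p.2 < g -> p.1 + p.2 < h ->
    nim_value_fuel g k l p = nim_value_fuel h k l p by move=> pf; apply: H.
elim: g h p => [//|g IH] [//|h] p pg ph /=.
by congr mex; apply/eq_in_map => q /options_decr qp; apply: IH; lia.
Qed.

Lemma nim_valueE (k l : nat) (p : position) :
  nim_value k l p = mex [seq nim_value k l q | q <- options k l p].
Proof.
rewrite {1}/nim_value /=; congr mex; apply/eq_in_map => q /options_decr qp.
exact: nim_value_fuelE.
Qed.

(* Main.v *)
Require Import Defs.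
From mathcomp Require Import all_boot all_order all_algebra.
From mathcomp Require Import zify ring lra.
From mathcomp Require Import mathcomp_extra boolp classical_sets reals.

(** Positions of value 0 with [a <= b] are the pairs [(i, i)] with [i < l]
    followed by the Wythoff pairs [(A_n, B_n)] translated by [l].  Those of
    value 1 are the pairs [(2i, 2i+1)] up to [(l-1, l)], the pair
    [(l+1, l+1)], and the Wythoff pairs of index [n >= 2] translated by
    [l-1]: the differences 0 and 1 are taken by [(l+1, l+1)] and [(l-1, l)],
    and the latter can be reached diagonally because [k < l].  The form in
    the theorem follows since [A_{n+1} - A_n] is 1 when [n] is some [B_j] and
    2 when [n] is some [A_j].  Both cases, as well as the complementarity of
    [A] and [B], come from the values of [A] at [A_j], [A_j + 1], [B_j] and
    [B_j + 1]. *)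

Import Order.TTheory GRing.Theory Num.Theory.

(** * Nim-values, and a criterion for the positions of a given value *)

Lemma eq_mex (s t : seq nat) : s =i t -> mex s = mex t.
Proof.
move=> st; have [sN sl] := mexP s; have [tN tl] := mexP t.
case: (ltngtP (mex s) (mex t)) => // h.
- by move: sN; rewrite st tl.
- by move: tN; rewrite -st sl.
Qed.

Lemma nim_value_option (k l : nat) (p q : position) :
  q \in options k l p -> nim_value k l q <> nim_value k l p.
Proof.
move=> qp; rewrite [in RHS]nim_valueE => e.
by case: (mexP [seq nim_value k l q | q <- options k l p]) => + _; rewrite -e map_f.
Qed.

Lemma nim_value_ltP (k l v : nat) (p : position) :
  v < nim_value k l p -> exists2 q, q \in options k l p & nim_value k l q = v.
Proof.
rewrite nim_valueE.
case: (mexP [seq nim_value k l q | q <- options k l p]) => _ h /h /mapP[q qp ->].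
by exists q.
Qed.

Lemma options_swap (k l a b c d : nat) :
  (c, d) \in options k l (a, b) -> (d, c) \in options k l (b, a).
Proof.
move=> /mem_options[s s0 H]; apply/mem_options; exists s => //.
case: H => [[? [-> ->]]|[? [-> ->]]|[? ? [-> ->] ? ?]].
- by constructor 2.
- by constructor 1.
- by constructor 3; rewrite minnC maxnC.
Qed.

Lemma nim_value_swap (k l a b : nat) :
  nim_value k l (a, b) = nim_value k l (b, a).
Proof.
have [N] := ubnP (a + b); elim: N a b => [//|N IH] a b ab.
rewrite !nim_valueE; apply: eq_mex => v.
have dec c d x y : (c, d) \in options k l (x, y) -> c + d < x + y.
  exact: options_decr.
apply/mapP/mapP => -[[c d] qp ->]; exists (d, c).
- exact: options_swap.
- by apply: IH; move: (dec _ _ _ _ qp); lia.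
- exact: options_swap.
- by apply: IH; move: (dec _ _ _ _ qp); lia.
Qed.

Lemma mem_options_row (k l a b c : nat) :
  c < b -> (a, c) \in options k l (a, b).
Proof.
move=> cb; apply/mem_options; exists (b - c); first by lia.
by constructor 2; split; [lia | congr pair; lia].
Qed.

(* The last hypothesis only concerns pairs from which no Nim move reaches [P]:
   the remaining ones reach it because [P] covers every coordinate. *)
Lemma nim_valueP (k l v : nat) (P : nat -> nat -> Prop) :
  (forall a b, P a b -> a <= b) ->
  (forall a, exists c, P a c \/ P c a) ->
  (forall a b c d, P a b -> P c d -> [\/ a = c, a = d, b = c | b = d] ->
     a = c /\ b = d) ->
  (forall a b s, 0 < s -> k <= a -> l <= b -> P a b -> ~ P (a + s) (b + s)) ->
  (forall a b, P a b -> v <= nim_value k l (a, b)) ->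
  (forall a b c, P a c -> a <= b < c -> nim_value k l (a, b) < v \/
     exists2 s, 0 < s <= a & [/\ P (a - s) (b - s), k <= a - s & l <= b - s]) ->
  forall a b, a <= b -> nim_value k l (a, b) = v <-> P a b.
Proof.
move=> Ple Ptot Pinj Pdiag Pval Pabs a b.
have [N] := ubnP (a + b); elim: N a b => [//|N IH] a b abN ab.
have Pneq c d : P c d -> c + d < a + b ->
    (c, d) \in options k l (a, b) \/ (d, c) \in options k l (a, b) ->
    nim_value k l (a, b) <> v.
  move=> Pcd cdN qp abv; have cd := Ple _ _ Pcd.
  have cdv : nim_value k l (c, d) = v by apply/IH => //; lia.
  case: qp => /nim_value_option; rewrite abv => h; apply: h; first exact: cdv.
  by rewrite nim_value_swap.
split=> [abv|Pab].
- have [c [Pac|Pca]] := Ptot a.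
  + have ac := Ple _ _ Pac; case: (ltngtP b c) => [bc|cb|->//].
    * have [|abv'|[s s0 [Ps ks ls]]] := Pabs a b c Pac; [lia|lia|].
      case: (Pneq _ _ Ps _ _ abv); [lia|left].
      by apply/mem_options; exists s; [lia | constructor 3; split => //; lia].
    * by case: (Pneq _ _ Pac _ _ abv); [lia | left; apply: mem_options_row].
  + have ca := Ple _ _ Pca; case: (ltnP c b) => [cb|bc].
    * by case: (Pneq _ _ Pca _ _ abv); [lia | right; apply: mem_options_row].
    * have ea : a = c by lia.
      have eb : b = c by lia.
      by rewrite eb {2}ea in Pca *; rewrite ea in Pca *.
(* Exceeding [v] would require an option of value [v], which by induction is in [P] up to order;
   [Pinj] excludes the Nim options and [Pdiag] the diagonal ones. *)
- have := Pval _ _ Pab; rewrite leq_eqVlt => /orP[/eqP->//|/nim_value_ltP].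
  move=> [[c d] qp qv]; have /= dec := options_decr qp; exfalso.
  have [Pcd|Pdc] : P c d \/ P d c.
  + case: (leqP c d) => cd; first by left; apply/IH; [lia|lia|exact: qv].
    by right; apply/IH; [lia|lia|rewrite nim_value_swap].
  + case/mem_options: qp => s s0 [[sa [ec ed]]|[sb [ec ed]]|[sa sb [ec ed] ks ls]].
    * by have := Pinj _ _ _ _ Pab Pcd (Or44 _ _ _ (esym ed)); lia.
    * by have := Pinj _ _ _ _ Pab Pcd (Or41 _ _ _ (esym ec)); lia.
    * apply: (Pdiag c d s) => //; [lia|lia|].
      by rewrite ec ed !subnK.
  + case/mem_options: qp => s s0 [[sa [ec ed]]|[sb [ec ed]]|[sa sb [ec ed] ks ls]].
    * by have := Pinj _ _ _ _ Pab Pdc (Or43 _ _ _ (esym ed)); lia.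
    * by have := Pinj _ _ _ _ Pab Pdc (Or42 _ _ _ (esym ec)); lia.
    * have := Ple _ _ Pdc => dc; have eab : a = b by lia.
      apply: (Pdiag d c s) => //; [lia|lia|].
      by have [-> ->] : d + s = a /\ c + s = b by lia.
Qed.

(** * The sequences [A] and [B]: gaps and complementarity *)

Section Wythoff.
Variable R : realType.
Local Notation A := (wythA R).
Local Notation B := (wythB R).
Local Notation phi := (phi R).

Lemma sqr_phi : (phi ^+ 2 = phi + 1)%R.
Proof.
have h : (Num.sqrt 5 ^+ 2 = 5 :> R)%R by rewrite sqr_sqrtr.
by rewrite /Defs.phi; field: h.
Qed.

Lemma phi_bounds : (1 < phi < 2)%R.
Proof.
have := sqr_phi; have : (0 < phi)%R.
  by rewrite /Defs.phi divr_gt0 // ltr_wpDr ?sqrtr_ge0.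
by nra.
Qed.

(** Infinite descent: a solution [(j, n)] yields [(n - j, j)], whose first entry is smaller if
    [j > 0]. *)
Lemma golden_descent (j n : nat) : n * n = n * j + j * j -> j = 0.
Proof.
have [N] := ubnP j; elim: N j n => [//|N IH] j n jN e.
have jn : j <= n by nia.
have r0 := IH (n - j) j.
by case: (posnP j) => // j0; have : n - j = 0; [apply: r0; nia|nia].
Qed.

Lemma phi_irrational (j n : nat) : 0 < j -> (j%:R * phi <> n%:R)%R.
Proof.
move=> j0 e; suff /golden_descent : n * n = n * j + j * j by lia.
apply/eqP; rewrite -(eqr_nat R) natrD !natrM -e; apply/eqP.
by have := sqr_phi; nra.
Qed.

Lemma wythA_itv (n : nat) : ((A n)%:R <= n%:R * phi < (A n)%:R + 1)%R.
Proof.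
have h : (0 <= n%:R * phi)%R.
  by apply: mulr_ge0 => //; have := phi_bounds; lra.
by rewrite natr1; apply: truncn_itv.
Qed.

Lemma wythA_eq (n v : nat) : (v%:R <= n%:R * phi < v%:R + 1)%R -> A n = v.
Proof. by rewrite natr1 => h; apply: truncn_def. Qed.

Lemma wythB_def (n : nat) : B n = A n + n.
Proof.
rewrite /wythB; apply: truncn_def.
rewrite sqr_phi -natr1 natrD.
by have := wythA_itv n; lra.
Qed.

Lemma wythA_gt (n : nat) : 0 < n -> ((A n)%:R < n%:R * phi)%R.
Proof.
move=> n0; have /andP[+ _] := wythA_itv n.
by rewrite le_eqVlt => /orP[/eqP/esym/phi_irrational|].
Qed.

Lemma wythA0 : A 0 = 0. Proof. by apply: wythA_eq; lra. Qed.

Lemma wythA1 : A 1 = 1.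
Proof. by apply: wythA_eq; have := phi_bounds; lra. Qed.

Lemma ltn_wythA : {homo A : i j / i < j}.
Proof.
apply: homo_ltn => [|i]; first exact: ltn_trans.
have := wythA_itv i; have := wythA_itv i.+1; have := phi_bounds.
rewrite -(ltr_nat R) -natr1.
by lra.
Qed.

Lemma wythAS (i : nat) : A i.+1 = A i + 1 \/ A i.+1 = A i + 2.
Proof.
have : A i < A i.+1 by apply: ltn_wythA.
suff : A i.+1 < A i + 3 by lia.
have := wythA_itv i; have := wythA_itv i.+1; have := phi_bounds.
rewrite -(ltr_nat R) natrD -natr1.
by lra.
Qed.

(* [f] is the fractional part of [j * phi], and [t = f * (phi - 1)]. *)
Lemma wythA_frac (j : nat) : 0 < j ->
  exists f t : R, [/\ (0 < t < f)%R, (t < phi - 1)%R, (f - t < 2 - phi)%R,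
    (j%:R * phi = (A j)%:R + f)%R & ((A j)%:R * phi = (B j)%:R - t)%R].
Proof.
move=> j0; have gt := wythA_gt _ j0; have := wythA_itv j; have := phi_bounds.
have := sqr_phi; rewrite wythB_def natrD.
move: (phi) gt => p gt p2 p12 lt.
exists (j%:R * p - (A j)%:R)%R, ((j%:R * p - (A j)%:R) * (p - 1))%R.
(* Since [f - t = f * (2 - phi)], these four products bound [t] and [f - t] on both sides. *)
have h1 : (0 < (j%:R * p - (A j)%:R) * (p - 1))%R by apply: mulr_gt0; lra.
have h2 : (0 < (j%:R * p - (A j)%:R) * (2 - p))%R by apply: mulr_gt0; lra.
have h3 : (0 < (1 - (j%:R * p - (A j)%:R)) * (p - 1))%R by apply: mulr_gt0; lra.
have h4 : (0 < (1 - (j%:R * p - (A j)%:R)) * (2 - p))%R by apply: mulr_gt0; lra.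
split; [lra | lra | lra | ring | ring: p2].
Qed.

(** [A j * phi] falls short of the integer [B j] by [t], and [0 < t < 1]. *)
Lemma wythAA (j : nat) : 0 < j -> A (A j) + 1 = B j.
Proof.
move=> j0; have [f [t [? ? ? ? eA]]] := wythA_frac _ j0.
suff -> : A (A j) = B j - 1 by rewrite wythB_def; lia.
apply: wythA_eq; rewrite natrB; last by rewrite wythB_def; lia.
by rewrite eA; have := phi_bounds; lra.
Qed.

(** Adding [phi] to [B j - t] passes [B j + 1], because [t < phi - 1]. *)
Lemma wythAA1 (j : nat) : 0 < j -> A (A j + 1) = B j + 1.
Proof.
move=> j0; have [f [t [? ? ? ? eA]]] := wythA_frac _ j0.
apply: wythA_eq; rewrite !natrD mulrDl eA mul1r.
by have := phi_bounds; lra.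
Qed.

(** As [B j = A j + j], the two equations add up: [B j * phi] is [f - t] above [A j + B j]. *)
Lemma wythAB (j : nat) : 0 < j -> A (B j) = A j + B j.
Proof.
move=> j0; have [f [t [? ? ? ej eA]]] := wythA_frac _ j0.
apply: wythA_eq; rewrite {2 3}wythB_def !natrD !mulrDl eA ej.
by rewrite wythB_def natrD; have := phi_bounds; lra.
Qed.

Lemma wythAB1 (j : nat) : 0 < j -> A (B j + 1) = A j + B j + 1.
Proof.
move=> j0; have [f [t [? ? ? ej eA]]] := wythA_frac _ j0.
apply: wythA_eq; rewrite !wythB_def !natrD !mulrDl eA ej.
by rewrite wythB_def natrD; have := phi_bounds; lra.
Qed.

Lemma leq_wythA (n : nat) : n <= A n.
Proof.
elim: n => // n IH; apply: leq_ltn_trans IH _; exact: ltn_wythA.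
Qed.

Lemma wythA_inj : injective A.
Proof.
move=> i j e; case: (ltngtP i j) => // /ltn_wythA; by rewrite e ltnn.
Qed.

(** [B j] lies strictly between the consecutive values [A (A j) = B j - 1] and
    [A (A j + 1) = B j + 1]. *)
Lemma wythA_neqB (i j : nat) : 0 < j -> A i <> B j.
Proof.
move=> j0 e; have h1 := wythAA _ j0; have h2 := wythAA1 _ j0.
case: (leqP i (A j)) => [|h].
- by rewrite leq_eqVlt => /orP[/eqP ei|/ltn_wythA]; [rewrite ei in e|]; lia.
- have : A (A j + 1) <= A i.
    move: h; rewrite -addn1 leq_eqVlt => /orP[/eqP->//|/ltn_wythA/ltnW //].
  by lia.
Qed.

Lemma wythA_interval (n : nat) : exists j, A j <= n < A j.+1.
Proof.
elim: n => [|n [j /andP[jn nj]]].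
  by exists 0; rewrite wythA0 wythA1.
case: (ltnP n.+1 (A j.+1)) => h; first by exists j; rewrite h leqW.
exists j.+1; rewrite h /=; have := ltn_wythA j.+1 j.+2 (ltnSn _); lia.
Qed.

Lemma wyth_cover (n : nat) : 0 < n -> exists2 j, 0 < j & n = A j \/ n = B j.
Proof.
have [N] := ubnP n; elim: N n => [//|N IH] n nN n0.
have [j /andP[jn nj]] := wythA_interval n.
have j0 : 0 < j by case: j jn nj => //; rewrite wythA1; lia.
case: (ltngtP (A j) n) => [jn'||<-]; [|lia|by exists j => //; left].
(* Now [n] is strictly inside the gap after [A j], which thus has length 2. By induction [j] is some
   [A i], giving [n = A (A i) + 1 = B i], or some [B i], after which the gap is only 1. *)
have := leq_wythA j => jA.
have [i i0 [eA|eB]] := IH j ltac:(lia) j0.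
- exists i => //; right; have := wythAA _ i0; rewrite -eA.
  by have := wythAS j; lia.
- have := wythAB1 _ i0; have := wythAB _ i0; rewrite -eB addn1; lia.
Qed.

Lemma wythA_succ_B (j : nat) : 0 < j -> A (B j).+1 = A (B j) + 1.
Proof. by move=> j0; rewrite wythAB // -wythAB1 // addn1. Qed.

Lemma wythA_succ_A (j : nat) : 0 < j -> A (A j).+1 = A (A j) + 2.
Proof.
by move=> j0; have := wythAA _ j0; have := wythAA1 _ j0; rewrite !addn1; lia.
Qed.

(** [A] and [B] meet only at index 0, and both increase strictly. This supplies the
    shared-coordinate condition of [nim_valueP]. *)
Lemma wyth_share (i j : nat) :
  [\/ A i = A j, A i = B j, B i = A j | B i = B j] -> i = j.
Proof.
have AB x y : A x = B y -> x = y.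
  case: (posnP y) => [->|y0 /wythA_neqB //].
  by rewrite wythB_def wythA0 => e; have := leq_wythA x; lia.
case=> [/wythA_inj //|/AB //|/esym/AB //|].
by rewrite !wythB_def; case: (ltngtP i j) => // h; have := ltn_wythA _ _ h; lia.
Qed.

End Wythoff.

(** * Positions of value 0 and of value 1 *)

Section NimValues.
Variable R : realType.
Local Notation A := (wythA R).
Local Notation B := (wythB R).

Definition zero_pair (l a b : nat) : Prop :=
  (a = b /\ a < l) \/ exists n, a = A n + l /\ b = B n + l.

Lemma nim_value_eq0 (k l a b : nat) : k <= l -> a <= b ->
  nim_value k l (a, b) = 0 <-> zero_pair l a b.
Proof.
move=> kl; move: a b; apply: nim_valueP.
- by move=> a b [|[n]]; rewrite ?wythB_def; lia.
- move=> a; case: (ltnP a l) => al; first by exists a; left; left.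
  case: (posnP (a - l)) => [al0|/(wyth_cover R)[j j0 [e|e]]].
  + by exists a; left; right; exists 0; rewrite wythB_def wythA0; lia.
  + by exists (B j + l); left; right; exists j; lia.
  + by exists (A j + l); right; right; exists j; lia.
- move=> a b c d [[ab al]|[n [an bn]]] [[cd cl]|[n' [cn dn]]] H.
  + by case: H; lia.
  + by case: H; lia.
  + by case: H; lia.
  + suff e : n = n' by rewrite e in an bn; lia.
    by apply: (wyth_share R); case: H; [constructor 1|constructor 2|constructor 3
      |constructor 4]; lia.
- move=> a b s s0 ka lb [[ab al]|[n [an bn]]]; first by lia.
  move=> [[abs asl]|[n' [an' bn']]]; first by lia.
  have e : n = n' by move: bn bn'; rewrite !wythB_def; lia.
  by rewrite e in an; lia.
- by [].
- move=> a b c [[ac al]|[n [an cn]]] abc; first by lia.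
  (* The translated Wythoff pair of index [b - a] is on the diagonal of [(a, b)], and lower because
     [b - a < n]. *)
  right; have bn : b - a < n by move: cn; rewrite wythB_def; lia.
  have An := ltn_wythA R _ _ bn; have Bn := wythB_def R (b - a).
  exists (A n - A (b - a)); first by lia.
  split; [right; exists (b - a)| |]; lia.
Qed.

(** Truncated subtraction is harmless here, as [A n >= 3] for [n > 1]. *)
Definition one_pair (l a b : nat) : Prop :=
  [\/ exists2 i, a = 2 * i & b = 2 * i + 1 /\ b <= l,
      a = l + 1 /\ b = l + 1
    | exists2 n, 1 < n & a = A n + l - 1 /\ b = B n + l - 1].

Lemma nim_value_eq1 (k l a b : nat) : odd l -> k < l -> a <= b ->
  nim_value k l (a, b) = 1 <-> one_pair l a b.
Proof.
move=> lo kl; have A2 : A 2 = 3.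
  by have := wythAA1 R 1 isT; rewrite wythB_def wythA1.
have A3 n : 1 < n -> 3 <= A n.
  rewrite -A2 leq_eqVlt => /orP[/eqP<-//|/(ltn_wythA R)/ltnW //].
move: a b; apply: nim_valueP.
- by move=> a b [[i]|//|[n]]; rewrite ?wythB_def; lia.
- move=> a; case: (leqP a l) => al.
    (* As [l] is odd, the numbers from 0 to [l] split into pairs [2i, 2i+1]. *)
    case: (boolP (odd a)) => ao.
      by exists (a - 1); right; constructor 1; exists (a./2); lia.
    by exists (a + 1); left; constructor 1; exists (a./2); lia.
  have [->|al1] := eqVneq a (l + 1); first by exists (l + 1); left; constructor 2.
  (* Here [a - l + 1 >= 3], which excludes index 1, where [A] and [B] are 1 and 2. *)
  have [|j j0 e] := wyth_cover R (a - l + 1); first by lia.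
  have j1 : 1 < j.
    case: (ltngtP 1 j) => // [|j1]; first by lia.
    by move: e; rewrite -j1 wythB_def wythA1; lia.
  case: e => e.
  + by exists (B j + l - 1); left; constructor 3; exists j; lia.
  + by exists (A j + l - 1); right; constructor 3; exists j; lia.
- have BA n := wythB_def R n.
  move=> a b c d [[i ai bi]|[al bl]|[n n1 [an bn]]]
    [[i' ci di]|[cl dl]|[n' n1' [cn dn]]] H;
    try (have := A3 _ n1); try (have := A3 _ n1');
    try (have := BA n); try (have := BA n'); move=> *;
    try by case: H; lia.
  suff e : n = n' by rewrite e in an bn; lia.
  by apply: (wyth_share R); case: H; [constructor 1|constructor 2|constructor 3
    |constructor 4]; lia.
- have BA n := wythB_def R n.
  move=> a b s s0 ka lb [[i ai bi]|[al bl]|[n n1 [an bn]]]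
    [[i' ci di]|[cl dl]|[n' n1' [cn dn]]];
    try (have := A3 _ n1); try (have := A3 _ n1');
    try (have := BA n); try (have := BA n'); move=> *; try lia.
  have e : n = n' by lia.
  by rewrite e in an; lia.
(* No such pair has value 0: for two Wythoff pairs, equal differences force equal indices, but the
   translations differ by 1. *)
- move=> a b Pab; rewrite lt0n; apply/eqP => /nim_value_eq0.
  have BA n := wythB_def R n; have B0 := BA 0; rewrite wythA0 in B0.
  have ab : a <= b.
    by case: Pab => [[i]|//|[n n1]]; rewrite ?wythB_def; lia.
  move=> /(_ (ltnW kl) ab) [[]|[n [an bn]]].
  + by case: Pab => [[i]||[n n1]]; [lia|lia|rewrite BA; have := A3 _ n1; lia].
  + have := BA n; case: Pab => [[i]||[n' n1' []]].
    * by lia.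
    * by move=> [al bl]; case: (posnP n) => [n0|]; [rewrite n0 wythA0 in an|]; lia.
    * have := A3 _ n1'; have := BA n' => ? ? ? ? ?.
      have e : n = n' by lia.
      by rewrite e in an; lia.
- move=> a b c [[i ai [ci cl]]|[al cl]|[n n1 [an cn]]] abc; last 2 first.
  + by lia.
  + right; have n3 := A3 _ n1.
    have bn : b - a < n by move: cn; rewrite wythB_def; lia.
    have An := ltn_wythA R _ _ bn; have Bn := wythB_def R (b - a).
    (* The targets for difference 0, at least 2, and 1 are [(l+1, l+1)], the Wythoff pair of index
       [b - a], and [(l-1, l)]; the last is allowed since [k <= l - 1]. *)
    case: (ltngtP (b - a) 1) => [d0|d1|d1].
    * exists (a - (l + 1)); first by lia.
      by split; [constructor 2| |]; lia.
    * have := A3 _ d1 => d3; exists (A n - A (b - a)); first by lia.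
      by split; [constructor 3; exists (b - a)| |]; lia.
    * exists (a - (l - 1)); first by lia.
      by split; [constructor 1; exists (l./2)| |]; lia.
  (* Only [b = a] lies in the range, and [(a, a)] with [a < l] has value 0. *)
  + left; have -> : b = a by lia.
    by rewrite ltnS leqn0; apply/eqP/nim_value_eq0; [lia|lia|left; lia].
Qed.

End NimValues.

(** * The value-1 pairs in the stated form *)

Local Open Scope classical_set_scope.

Theorem theorem7 (R : realType) (m l k : nat) (hl : l = 2 * m + 1)
    (hk : k < l) :
  [set p : position | p.1 <= p.2 /\ nim_value k l p = 1]
  = [set (2 * i, 2 * i + 1) | i in [set i : nat | 0 <= i <= m]]
    `|` [set (l + 1, l + 1)]
    `|` [set (wythA R n + l, wythB R n + l + 1)
          | n in [set n : nat | exists2 j : nat, 1 <= j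
                    & n = Num.truncn (j%:R * phi R ^+ 2)%R]]
    `|` [set (wythA R n + l + 1, wythB R n + l + 2)
          | n in [set n : nat | exists2 j : nat, 1 <= j
                    & n = Num.truncn (j%:R * phi R)%R]].
Proof.
have lo : odd l by lia.
have BA n := wythB_def R n.
have one a b := nim_value_eq1 R k l a b lo hk.
apply/seteqP; split=> [[a b] /= [ab /(one _ _ ab)]|[a b] /= H].
- case=> [[i -> [-> il]]|[-> ->]|[n n1 [-> ->]]].
  + by left; left; left; exists i => //=; lia.
  + by left; left; right.
  (* The index drops by one. The new [n] is some [A j] or [B j], so [A] grows by 2 or 1 from [n] to
     [n + 1], which selects the last or the third family. *)
  + case: n n1 => [//|n] n1.
    have [j j0 [e|e]] := wyth_cover R n n1.
    * right; exists n; first by exists j.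
      have := wythA_succ_A R j j0; rewrite -e => eA.
      by rewrite !BA eA; congr pair; lia.
    * left; right; exists n; first by exists j.
      have := wythA_succ_B R j j0; rewrite -e => eA.
      by rewrite !BA eA; congr pair; lia.
- suff P : one_pair R l a b.
    have ab : a <= b by case: P => [[i]|//|[n]]; rewrite ?BA; lia.
    by split=> //; apply/one.
  case: H => [[[[i im [<- <-]]|[-> ->]]|[n [j j0 e] [<- <-]]]|[n [j j0 e] [<- <-]]].
  + by constructor 1; exists i; lia.
  + by constructor 2.
  + have -> : n = wythB R j := e; have jA := leq_wythA R j.
    constructor 3; exists (wythB R j).+1; first by rewrite BA; lia.
    by rewrite ![wythB R _.+1]BA wythA_succ_B // [wythB R (wythB R j)]BA; lia.
  + have -> : n = wythA R j := e; have jA := leq_wythA R j.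
    constructor 3; exists (wythA R j).+1; first by lia.
    by rewrite !BA wythA_succ_A //; lia.
Qed.
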